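(* Let $h:\mathbb{Z}_{\ge0}\to\mathbb{Z}_{\ge0}$ be nondecreasing and satisfy condition (a): for all $z,z'\in\mathbb{Z}_{\ge0}$ and every positive integer $i$, if $\lfloor z/2^i\rfloor=\lfloor z'/2^i\rfloor$ then $\lfloor h(z)/2^{i-1}\rfloor=\lfloor h(z')/2^{i-1}\rfloor$. Let $s$ be a positive integer such that $i\oplus s=i+s$ for $i=0,1,2,\dots,h(s)$, and let $h_s(z)=h(z+s)$ for all $z\in\mathbb{Z}_{\ge0}$. Then $G_{h_s}(\{y,z\})=(y\oplus(z+s))-s$ for all $y,z\in\mathbb{Z}_{\ge0}$ with $y\le h_s(z)$.
   Context: $\oplus$ denotes nim-sum (bitwise XOR). For a nondecreasing $f:\mathbb{Z}_{\ge0}\to\mathbb{Z}_{\ge0}$, positions of the chocolate bar game $CB(f,y,z)$ are pairs $\{y,z\}$ with $y\le f(z)$ (bar with $z+1$ columns, column 0 bitter, column $i$ of height $\min(f(i),y)+1$). Moves: $move_f(\{y,z\})=\{\{v,z\}:v<y\}\cup\{\{\min(y,f(w)),w\}:w<z\}$. Grundy number: $G_f(\{y,z\})=\mathrm{mex}\{G_f(p):p\in move_f(\{y,z\})\}$, mex being the least nonnegative integer not in the set. *)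

(* Defs.v *)
From Stdlib Require Export Arith List ZArith.
From Stdlib Require Import Lia.
Import ListNotations.

Definition nondecreasing (f : nat -> nat) : Prop :=
  forall a b : nat, a <= b -> f a <= f b.

(* [/] is Euclidean division on [nat], i.e. the floor of the quotient. *)
Definition condition_a (h : nat -> nat) : Prop :=
  forall z z' i : nat, 0 < i ->
    z / 2 ^ i = z' / 2 ^ i -> h z / 2 ^ (i - 1) = h z' / 2 ^ (i - 1).

Definition translate (h : nat -> nat) (s : nat) : nat -> nat := fun z => h (z + s).

(* The position {y, z} is the ordered pair (y, z), subject to y <= f z. *)
Definition position (f : nat -> nat) (p : nat * nat) : Prop := fst p <= f (snd p).

Definition moves (f : nat -> nat) (p : nat * nat) : list (nat * nat) :=
  let (y, z) := p in
  map (fun v => (v, z)) (seq 0 y) ++ map (fun w => (min y (f w), w)) (seq 0 z).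

(* The search stops within [0 .. length l] by the pigeonhole principle, so the
   default value 0 is never used: see [mex_spec]. *)
Definition mex (l : list nat) : nat :=
  match find (fun k => if in_dec Nat.eq_dec k l then false else true)
             (seq 0 (S (length l))) with
  | Some k => k
  | None => 0
  end.

(* Every move strictly decreases y + z, so S (y + z) steps of recursion suffice:
   see [grundy_unfold]. *)
Fixpoint grundy_rec (f : nat -> nat) (n : nat) (p : nat * nat) : nat :=
  match n with
  | 0 => 0
  | S m => mex (map (grundy_rec f m) (moves f p))
  end.

Definition grundy (f : nat -> nat) (p : nat * nat) : nat :=
  grundy_rec f (S (fst p + snd p)) p.

Lemma in_moves (f : nat -> nat) (y z : nat) (q : nat * nat) :
  In q (moves f (y, z)) <->
  (exists v, v < y /\ q = (v, z)) \/ (exists w, w < z /\ q = (min y (f w), w)).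
Proof.
  unfold moves; rewrite in_app_iff, !in_map_iff; split.
  - intros [[v [<- Hv]] | [w [<- Hw]]].
    + apply in_seq in Hv. left; exists v; split; [lia | reflexivity].
    + apply in_seq in Hw. right; exists w; split; [lia | reflexivity].
  - intros [[v [Hv ->]] | [w [Hw ->]]].
    + left; exists v; split; [reflexivity | apply in_seq; lia].
    + right; exists w; split; [reflexivity | apply in_seq; lia].
Qed.

Lemma moves_position (f : nat -> nat) (p q : nat * nat) :
  position f p -> In q (moves f p) -> position f q.
Proof.
  destruct p as [y z]; unfold position; simpl fst; simpl snd; intros Hp Hq.
  apply in_moves in Hq as [[v [Hv ->]] | [w [Hw ->]]]; simpl; lia.
Qed.

Lemma moves_decrease (f : nat -> nat) (p q : nat * nat) :
  In q (moves f p) -> fst q + snd q < fst p + snd p.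
Proof.
  destruct p as [y z]; intros Hq.
  apply in_moves in Hq as [[v [Hv ->]] | [w [Hw ->]]]; simpl; lia.
Qed.

Lemma find_seq (P : nat -> bool) (n a k : nat) :
  find P (seq a n) = Some k -> P k = true /\ forall j, a <= j < k -> P j = false.
Proof.
  revert a; induction n as [|n IH]; intros a; simpl; [discriminate|].
  destruct (P a) eqn:E.
  - intros [= <-]; split; [exact E | intros j Hj; lia].
  - intros H; apply IH in H as [H1 H2]; split; [exact H1|].
    intros j Hj; destruct (Nat.eq_dec j a) as [->|Hne]; [exact E | apply H2; lia].
Qed.

Lemma mex_spec (l : list nat) :
  ~ In (mex l) l /\ forall k, k < mex l -> In k l.
Proof.
  unfold mex; destruct (find _ _) as [k|] eqn:E.
  - apply find_seq in E as [H1 H2]; split.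
    + destruct (in_dec Nat.eq_dec k l); [discriminate | assumption].
    + intros j Hj; specialize (H2 j ltac:(lia)).
      destruct (in_dec Nat.eq_dec j l); [assumption | discriminate].
  - exfalso.
    assert (Hi : incl (seq 0 (S (length l))) l).
    { intros x Hx; pose proof (find_none _ _ E x Hx) as Hn; simpl in Hn.
      destruct (in_dec Nat.eq_dec x l); [assumption | discriminate]. }
    pose proof (NoDup_incl_length (seq_NoDup (S (length l)) 0) Hi) as Hl.
    rewrite length_seq in Hl; lia.
Qed.

Lemma grundy_rec_stable (f : nat -> nat) (n m : nat) (p : nat * nat) :
  fst p + snd p < n -> fst p + snd p < m -> grundy_rec f n p = grundy_rec f m p.
Proof.
  revert m p; induction n as [|n IH]; intros m p Hn Hm; [lia|].
  destruct m as [|m]; [lia|]; simpl; f_equal; apply map_ext_in; intros q Hq.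
  apply moves_decrease in Hq; apply IH; lia.
Qed.

Lemma grundy_unfold (f : nat -> nat) (p : nat * nat) :
  grundy f p = mex (map (grundy f) (moves f p)).
Proof.
  unfold grundy at 1; simpl; f_equal; apply map_ext_in; intros q Hq.
  apply moves_decrease in Hq; apply grundy_rec_stable; lia.
Qed.

(* Main.v *)
Require Import Defs.
From Stdlib Require Import Lia.

(** Let [j] be the top bit at which [z] and [w] differ.  Condition (a) says that
    the bits of [h z] and [h w] then agree from position [j] on (not merely above
    [j]), so a change of [min y (h _)] can never compensate the change of bit [j]
    in the nim-sum.  The same determinacy lets one solve
    [min y (h w) (+) w = k] for [w] bit by bit from the top.  Finally, the
    hypothesis on [s] means that [h s] is smaller than the largest power of two
    dividing [s]; hence nim-sums of positions in columns [>= s] are [>= s] and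
    those in columns [< s] are [< s], so that removing the first [s] columns
    removes exactly the options of value [< s]. *)

(** * Binary digits, quotients by powers of two and nim-sums *)

Lemma pow2_neq_0 (n : nat) : 2 ^ n <> 0.
Proof. apply Nat.pow_nonzero; lia. Qed.

#[local] Hint Resolve pow2_neq_0 : core.

Lemma lxor_div_pow2 (a b n : nat) :
  Nat.lxor a b / 2 ^ n = Nat.lxor (a / 2 ^ n) (b / 2 ^ n).
Proof. rewrite <- !Nat.shiftr_div_pow2; apply Nat.shiftr_lxor. Qed.

Lemma div_pow2_add (a m n : nat) : a / 2 ^ (m + n) = a / 2 ^ m / 2 ^ n.
Proof. rewrite Nat.Div0.div_div, Nat.pow_add_r; reflexivity. Qed.

Lemma div_pow2_eq_le (a b m n : nat) :
  m <= n -> a / 2 ^ m = b / 2 ^ m -> a / 2 ^ n = b / 2 ^ n.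
Proof.
  intros Hmn E; replace n with (m + (n - m)) by lia.
  rewrite !div_pow2_add, E; reflexivity.
Qed.

Lemma div_pow2_testbit (a n : nat) :
  a / 2 ^ n = 2 * (a / 2 ^ S n) + Nat.b2n (Nat.testbit a n).
Proof.
  rewrite <- (Nat.add_1_r n), div_pow2_add, Nat.testbit_spec', Nat.pow_1_r.
  apply Nat.div_mod_eq.
Qed.

Lemma lt_of_div_lt (a b c : nat) : a / c < b / c -> a < b.
Proof.
  intros H; apply Nat.nle_gt; intros Hle.
  pose proof (Nat.Div0.div_le_mono _ _ c Hle); lia.
Qed.

Lemma lt_of_top_bit (a b j : nat) :
  a / 2 ^ S j = b / 2 ^ S j ->
  Nat.testbit a j = false -> Nat.testbit b j = true -> a < b.
Proof.
  intros E Ha Hb; apply lt_of_div_lt with (2 ^ j).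
  rewrite (div_pow2_testbit a), (div_pow2_testbit b), E, Ha, Hb; simpl; lia.
Qed.

Lemma lt_top_bit (a b : nat) :
  a < b ->
  exists j, a / 2 ^ S j = b / 2 ^ S j /\
            Nat.testbit a j = false /\ Nat.testbit b j = true.
Proof.
  intros Hab.
  assert (Hn : a / 2 ^ b = b / 2 ^ b).
  { pose proof (Nat.pow_gt_lin_r 2 b ltac:(lia)).
    rewrite !Nat.div_small by lia; reflexivity. }
  (* Only the two exponents are generalized; the induction then descends to the lowest exponent at
     which the quotients still agree. *)
  revert Hn; generalize b at 1 3 as n.
  induction n as [|n IH]; intros E.
  - rewrite Nat.pow_0_r, !Nat.div_1_r in E; lia.
  - destruct (Nat.eq_dec (a / 2 ^ n) (b / 2 ^ n)) as [E'|NE]; [exact (IH E')|].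
    exists n; split; [exact E|].
    pose proof (Nat.Div0.div_le_mono a b (2 ^ n) ltac:(lia)) as Hle.
    rewrite (div_pow2_testbit a), (div_pow2_testbit b), E in NE, Hle.
    destruct (Nat.testbit a n), (Nat.testbit b n); simpl in *; split; lia.
Qed.

Lemma lxor_cancel_r (a b c : nat) : Nat.lxor a c = Nat.lxor b c -> a = b.
Proof.
  intros E; apply (f_equal (fun x => Nat.lxor x c)) in E.
  rewrite !Nat.lxor_assoc, Nat.lxor_nilpotent, !Nat.lxor_0_r in E; exact E.
Qed.

Lemma lxor_cancel_l (a b c : nat) : Nat.lxor c a = Nat.lxor c b -> a = b.
Proof. rewrite !(Nat.lxor_comm c); apply lxor_cancel_r. Qed.

Lemma min_div (a b c : nat) : Nat.min a b / c = Nat.min (a / c) (b / c).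
Proof.
  destruct (Nat.le_ge_cases a b) as [H|H];
    pose proof (Nat.Div0.div_le_mono _ _ c H).
  - rewrite !Nat.min_l by assumption; reflexivity.
  - rewrite !Nat.min_r by assumption; reflexivity.
Qed.

(** * Consequences of condition (a) *)

Lemma condition_a_succ (h : nat -> nat) (z z' j : nat) :
  condition_a h -> z / 2 ^ S j = z' / 2 ^ S j -> h z / 2 ^ j = h z' / 2 ^ j.
Proof.
  intros Ha E; specialize (Ha z z' (S j) ltac:(lia) E).
  replace (S j - 1) with j in Ha by lia; exact Ha.
Qed.

Lemma condition_a_same (h : nat -> nat) (z z' n : nat) :
  condition_a h -> z / 2 ^ n = z' / 2 ^ n -> h z / 2 ^ n = h z' / 2 ^ n.
Proof.
  intros Ha E; destruct n as [|n].
  - rewrite Nat.pow_0_r, !Nat.div_1_r in *; congruence.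
  - apply div_pow2_eq_le with n; [lia|]; apply condition_a_succ; assumption.
Qed.

Lemma condition_a_min (h : nat -> nat) (y : nat) :
  condition_a h -> condition_a (fun w => Nat.min y (h w)).
Proof.
  intros Ha z z' i Hi E; rewrite !min_div, (Ha z z' i Hi E); reflexivity.
Qed.

(** [n] counts the low bits of [w] still free. The bits of [g w] from position [n] on depend only on
    [w / 2 ^ S n], so bit [n] of [w] can be chosen to match [k] without disturbing them. *)
Lemma condition_a_lxor_solve (g : nat -> nat) (k n w : nat) :
  condition_a g ->
  Nat.lxor (g w) w / 2 ^ n = k / 2 ^ n ->
  exists w', w' / 2 ^ n = w / 2 ^ n /\ Nat.lxor (g w') w' = k.
Proof.
  intros Ha; revert w; induction n as [|n IH]; intros w E.
  - exists w; rewrite Nat.pow_0_r, !Nat.div_1_r in E; auto.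
  (* The bits from [n] on are forced by [k]; the zeros below are placeholders for the induction
     hypothesis. *)
  - set (w1 := Nat.lxor (g w / 2 ^ n) (k / 2 ^ n) * 2 ^ n).
    assert (E1 : w1 / 2 ^ n = Nat.lxor (g w / 2 ^ n) (k / 2 ^ n))
      by (apply Nat.div_mul; auto).
    assert (E2 : w1 / 2 ^ S n = w / 2 ^ S n).
    { rewrite <- (Nat.add_1_r n), !div_pow2_add, E1, lxor_div_pow2.
      rewrite <- !div_pow2_add, Nat.add_1_r, <- E, lxor_div_pow2.
      rewrite <- Nat.lxor_assoc, Nat.lxor_nilpotent; apply Nat.lxor_0_l. }
    destruct (IH w1) as [w' [Hw' Hk]].
    + rewrite lxor_div_pow2, E1, (condition_a_succ g w1 w n Ha E2).
      rewrite <- Nat.lxor_assoc, Nat.lxor_nilpotent; apply Nat.lxor_0_l.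
    + exists w'; split; [|exact Hk].
      rewrite <- E2; apply div_pow2_eq_le with n; [lia | exact Hw'].
Qed.

(** * Nim-sums of the options of a position *)

Lemma column_move_changes_lxor (h : nat -> nat) (y z w : nat) :
  nondecreasing h -> condition_a h -> y <= h z -> w < z ->
  Nat.lxor (Nat.min y (h w)) w <> Nat.lxor y z.
Proof.
  intros Hmono Ha Hy Hw E.
  destruct (lt_top_bit w z Hw) as [j [Ej [Hwj Hzj]]].
  pose proof (condition_a_succ h w z j Ha Ej) as Eh.
  assert (Em : Nat.min y (h w) / 2 ^ j = y / 2 ^ j).
  { rewrite min_div, Eh; apply Nat.min_l, Nat.Div0.div_le_mono, Hy. }
  apply (f_equal (fun x => x / 2 ^ j)) in E.
  rewrite !lxor_div_pow2, Em in E; apply lxor_cancel_l in E.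
  rewrite (div_pow2_testbit w), (div_pow2_testbit z), Ej, Hwj, Hzj in E.
  simpl in E; lia.
Qed.

(** At the top bit where [k] and the nim-sum differ, exactly one of [y] and [z] has a 1. If it is
    [y], lower [y] to the nim-sum of [k] and [z]; otherwise solve for a smaller column. *)
Lemma smaller_lxor_reached (h : nat -> nat) (y z k : nat) :
  condition_a h -> y <= h z -> k < Nat.lxor y z ->
  (exists v, v < y /\ Nat.lxor v z = k) \/
  (exists w, w < z /\ Nat.lxor (Nat.min y (h w)) w = k).
Proof.
  intros Ha Hy Hk.
  destruct (lt_top_bit _ _ Hk) as [j [Ej [Hkj Hxj]]].
  rewrite Nat.lxor_spec in Hxj.
  destruct (Nat.testbit y j) eqn:Hyj.
  - left; exists (Nat.lxor k z).
    rewrite Nat.lxor_assoc, Nat.lxor_nilpotent, Nat.lxor_0_r; split; [|reflexivity].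
    apply lt_of_top_bit with j; [| |exact Hyj].
    + rewrite lxor_div_pow2, Ej, lxor_div_pow2.
      rewrite Nat.lxor_assoc, Nat.lxor_nilpotent; apply Nat.lxor_0_r.
    + rewrite Nat.lxor_spec, Hkj; destruct (Nat.testbit z j); easy.
  - right.
    pose proof (condition_a_min h y Ha) as Hg.
    destruct (condition_a_lxor_solve _ k (S j) z Hg) as [w [Hw Hwk]].
    { cbv beta; rewrite Nat.min_l by exact Hy; symmetry; exact Ej. }
    exists w; split; [|exact Hwk].
    apply lt_of_top_bit with j; [exact Hw| |exact Hxj].
    (* The new height agrees with [y] from bit [j] on, so its bit [j] is 0; bit [j] of [k] being 0,
       so is that of [w]. *)
    pose proof (condition_a_succ _ w z j Hg Hw) as Em; cbv beta in Em.
    rewrite (Nat.min_l y (h z)) in Em by exact Hy.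
    assert (Hbit : Nat.testbit (Nat.min y (h w)) j = false).
    { rewrite <- Hyj; apply Nat.b2n_inj; rewrite !Nat.testbit_spec', Em; reflexivity. }
    rewrite <- Hwk, Nat.lxor_spec, Hbit in Hkj; exact Hkj.
Qed.

(** * The hypothesis on [s] and the comparison of nim-sums with [s] *)

Lemma pow2_odd_decomposition (s : nat) :
  0 < s -> exists n m, s = 2 ^ n * (2 * m + 1).
Proof.
  induction s as [s IH] using lt_wf_ind; intros Hs.
  destruct (Nat.Even_or_Odd s) as [[t Ht]|[t Ht]].
  - destruct (IH t ltac:(lia) ltac:(lia)) as [n [m E]].
    exists (S n), m; rewrite Nat.pow_succ_r'; lia.
  - exists 0, t; simpl; lia.
Qed.

Lemma disjoint_below_pow2_divisor (s b : nat) :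
  0 < s -> (forall i, i <= b -> Nat.lxor i s = i + s) ->
  exists n, b < 2 ^ n /\ s = 2 ^ n * (s / 2 ^ n).
Proof.
  intros Hs Hdisj.
  destruct (pow2_odd_decomposition s Hs) as [n [m Es]]; exists n; split.
  (* Take [i = 2 ^ n]: bit [n] of [s] is set, so the sum carries into the quotient by [2 ^ S n] and
     the nim-sum does not. *)
  - apply Nat.nle_gt; intros Hle; specialize (Hdisj _ Hle).
    pose proof (pow2_neq_0 n).
    assert (E1 : (2 ^ n) / 2 ^ S n = 0)
      by (apply Nat.div_small; rewrite Nat.pow_succ_r'; lia).
    assert (E2 : s / 2 ^ S n = m)
      by (symmetry; apply Nat.div_unique with (2 ^ n); rewrite Nat.pow_succ_r'; lia).
    assert (E3 : (2 ^ n + s) / 2 ^ S n = S m)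
      by (symmetry; apply Nat.div_unique with 0; rewrite Nat.pow_succ_r'; lia).
    apply (f_equal (fun x => x / 2 ^ S n)) in Hdisj.
    rewrite lxor_div_pow2, E1, E2, E3, Nat.lxor_0_l in Hdisj; lia.
  - rewrite Es at 2; rewrite (Nat.mul_comm (2 ^ n) (2 * m + 1)), Nat.div_mul by auto.
    exact Es.
Qed.

(** If [z] and [s] share their quotient by [2 ^ n], then [y < 2 ^ n] and that quotient survives.
    Otherwise their top differing bit is some [j >= n], and [y < 2 ^ j] leaves intact the bit that
    makes [z] exceed [s]. *)
Lemma lxor_ge_of_pow2_divisor (h : nat -> nat) (s n y z : nat) :
  condition_a h -> h s < 2 ^ n -> s = 2 ^ n * (s / 2 ^ n) ->
  s <= z -> y <= h z -> s <= Nat.lxor y z.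
Proof.
  intros Ha Hn Hs Hz Hy.
  destruct (Nat.eq_dec (z / 2 ^ n) (s / 2 ^ n)) as [E|NE].
  - assert (Ey : y / 2 ^ n = 0).
    { pose proof (condition_a_same h z s n Ha E) as Eh.
      rewrite (Nat.div_small (h s)) in Eh by exact Hn.
      pose proof (Nat.Div0.div_le_mono _ _ (2 ^ n) Hy); lia. }
    pose proof (Nat.Div0.mul_div_le (Nat.lxor y z) (2 ^ n)) as Hle.
    rewrite lxor_div_pow2, Ey, Nat.lxor_0_l, E in Hle; lia.
  - assert (Hlt : s < z) by (destruct (Nat.eq_dec s z); [congruence | lia]).
    destruct (lt_top_bit s z Hlt) as [j [Ej [Hsj Hzj]]].
    assert (Hj : n <= j).
    { apply Nat.nlt_ge; intros Hj; apply NE; symmetry.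
      apply div_pow2_eq_le with (S j); assumption. }
    pose proof (Nat.pow_le_mono_r 2 n j ltac:(lia) Hj).
    pose proof (condition_a_succ h s z j Ha Ej) as Eh.
    rewrite (Nat.div_small (h s)) in Eh by lia.
    pose proof (Nat.Div0.div_le_mono _ _ (2 ^ j) Hy).
    apply Nat.lt_le_incl, lt_of_div_lt with (2 ^ j).
    replace (Nat.lxor y z / 2 ^ j) with (z / 2 ^ j).
    + rewrite (div_pow2_testbit s), (div_pow2_testbit z), Ej, Hsj, Hzj; simpl; lia.
    + rewrite lxor_div_pow2; replace (y / 2 ^ j) with 0 by lia.
      symmetry; apply Nat.lxor_0_l.
Qed.

Lemma lxor_lt_of_pow2_divisor (s n y w : nat) :
  y < 2 ^ n -> s = 2 ^ n * (s / 2 ^ n) -> w < s -> Nat.lxor y w < s.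
Proof.
  intros Hy Hs Hw.
  assert (Hlt : w / 2 ^ n < s / 2 ^ n)
    by (apply Nat.Div0.div_lt_upper_bound; lia).
  apply lt_of_div_lt with (2 ^ n).
  rewrite lxor_div_pow2, (Nat.div_small y) by exact Hy.
  rewrite Nat.lxor_0_l; exact Hlt.
Qed.

(** * Characterization of Grundy values and conclusion *)

Lemma mex_unique (l : list nat) (n : nat) :
  ~ In n l -> (forall k, k < n -> In k l) -> mex l = n.
Proof.
  intros Hn Hlt; destruct (mex_spec l) as [Hm Hmlt].
  destruct (Nat.lt_trichotomy (mex l) n) as [H|[H|H]];
    [exfalso; auto | exact H | exfalso; auto].
Qed.

Lemma grundy_unique (f : nat -> nat) (G : nat * nat -> nat) :
  (forall p, position f p ->
     (forall q, In q (moves f p) -> G q <> G p) /\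
     (forall k, k < G p -> exists q, In q (moves f p) /\ G q = k)) ->
  forall p, position f p -> grundy f p = G p.
Proof.
  intros HG.
  enough (H : forall N p, fst p + snd p < N -> position f p -> grundy f p = G p)
    by (intros p; apply (H (S (fst p + snd p))); lia).
  induction N as [|N IH]; intros p HN Hp; [lia|].
  assert (Hq : forall q, In q (moves f p) -> grundy f q = G q).
  { intros q Hq; apply IH; [apply moves_decrease in Hq; lia|].
    exact (moves_position f p q Hp Hq). }
  rewrite grundy_unfold, (map_ext_in _ _ _ Hq).
  destruct (HG p Hp) as [Hne Hreach]; apply mex_unique.
  - rewrite in_map_iff; intros [q [E Hin]]; exact (Hne q Hin E).
  - intros k Hk; rewrite in_map_iff.
    destruct (Hreach k Hk) as [q [Hin E]]; exists q; auto.
Qed.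

Theorem mainTheorem4 :
  forall (h : nat -> nat) (s : nat),
    nondecreasing h ->
    condition_a h ->
    0 < s ->
    (forall i : nat, i <= h s -> Nat.lxor i s = i + s) ->
    forall y z : nat,
      position (translate h s) (y, z) ->
      Z.of_nat (grundy (translate h s) (y, z))
      = (Z.of_nat (Nat.lxor y (z + s)) - Z.of_nat s)%Z.
Proof.
  intros h s Hmono Ha Hs Hdisj.
  destruct (disjoint_below_pow2_divisor s (h s) Hs Hdisj) as [n [Hn Hsn]].
  (* This makes the truncated subtraction of [s] exact at every position and option. *)
  assert (Hge : forall y z, y <= h (z + s) -> s <= Nat.lxor y (z + s)).
  { intros y z Hy; apply lxor_ge_of_pow2_divisor with h n; auto; lia. }
  intros y z Hp.
  rewrite (grundy_unique (translate h s) (fun p => Nat.lxor (fst p) (snd p + s) - s));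
    [| clear y z Hp | exact Hp].
  { cbn [fst snd]; rewrite Nat2Z.inj_sub; [reflexivity | exact (Hge y z Hp)]. }
  intros [y z] Hp; unfold position, translate in Hp; cbn [fst snd] in *.
  pose proof (Hge y z Hp) as Hyz; split.
  - intros q Hq E; apply in_moves in Hq as [[v [Hv ->]]|[w [Hw ->]]];
      unfold translate in *; cbn [fst snd] in E.
    + pose proof (Hge v z ltac:(lia)).
      assert (v = y) by (apply lxor_cancel_r with (z + s); lia); lia.
    + pose proof (Hge (Nat.min y (h (w + s))) w ltac:(lia)).
      apply (column_move_changes_lxor h y (z + s) (w + s) Hmono Ha Hp); lia.
  - intros k Hk.
    destruct (smaller_lxor_reached h y (z + s) (k + s) Ha Hp ltac:(lia))
      as [[v [Hv E]]|[w [Hw E]]].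
    + exists (v, z); rewrite in_moves; split; [left; eauto | cbn [fst snd]; lia].
    (* A column [w < s] has height at most [h s < 2 ^ n], so its nim-sum would be below [s], whereas
       it equals [k + s]. *)
    + assert (Hsw : s <= w).
      { apply Nat.nlt_ge; intros Hlt.
        pose proof (Hmono w s ltac:(lia)).
        pose proof (lxor_lt_of_pow2_divisor s n (Nat.min y (h w)) w
                      ltac:(lia) Hsn Hlt); lia. }
      exists (Nat.min y (h w), w - s); rewrite in_moves; unfold translate.
      cbn [fst snd]; rewrite Nat.sub_add by exact Hsw; split; [|lia].
      right; exists (w - s); rewrite Nat.sub_add by exact Hsw.
      split; [lia | reflexivity].
Qed.
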